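(* For all even integers $n\geq 4$ and every $\lambda>-\frac12$, the best Markov constant satisfies $$\frac{(n+2)(n+2\lambda)\big(n+\lambda+\frac12\big)^2}{(2\lambda+1)(2\lambda+5)}\leq c_n^2(\lambda)\leq\frac{n(n+2\lambda)(n+2\lambda+2)\sqrt{(n+2)(n+2\lambda+3)}}{2(2\lambda+1)\sqrt{2\lambda+5}}.$$
   Context: $\mathcal{P}_n$ denotes the class of real algebraic polynomials of degree at most $n$. For $\lambda>-1/2$, $w_\lambda(t)=(1-t^2)^{\lambda-1/2}$ on $(-1,1)$ and $\Vert f\Vert_{w_\lambda}=\big(\int_{-1}^1 w_\lambda(t)f^2(t)\,dt\big)^{1/2}$. The best Markov constant is $c_n(\lambda)=\sup\{\Vert p'\Vert_{w_\lambda}/\Vert p\Vert_{w_\lambda}: p\in\mathcal{P}_n,\ p\neq 0\}$. *)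

(* Defs.v *)
From HB Require Import structures.
From mathcomp Require Import all_boot all_order all_algebra.
From mathcomp Require Import all_classical all_reals all_analysis.
Set Implicit Arguments. Unset Strict Implicit. Unset Printing Implicit Defensive.
Import Order.TTheory GRing.Theory Num.Theory.
Import numFieldNormedType.Exports.
Local Open Scope classical_set_scope.
Local Open Scope ring_scope.

Definition gweight (R : realType) (lam : R) (t : R) : R :=
  (1 - t ^+ 2) `^ (lam - 2^-1).

Definition wint (R : realType) (lam : R) (f : R -> R) : \bar R :=
  let I := `](-1 : R), (1 : R)[%classic in
  (\int[lebesgue_measure]_(t in I) (gweight lam t * f t ^+ 2)%:E)%E.

Definition wnorm (R : realType) (lam : R) (f : R -> R) : R :=
  Num.sqrt (fine (wint lam f)).

Definition markov_const (R : realType) (n : nat) (lam : R) : R :=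
  sup [set wnorm lam (fun t => (p^`()).[t]) / wnorm lam (fun t => p.[t])
      | p in [set p : {poly R} | (size p <= n.+1)%N /\ p != 0]].

(* Main.v *)
Require Import Defs.
From HB Require Import structures.
From mathcomp Require Import all_boot all_order all_algebra.
From mathcomp Require Import all_classical all_reals all_analysis.
From mathcomp Require Import measurable_realfun ring lra.
Set Implicit Arguments. Unset Strict Implicit. Unset Printing Implicit Defensive.
Import Order.TTheory GRing.Theory Num.Theory.
Import numFieldNormedType.Exports.
Local Open Scope ring_scope.

(** Let [P_k = C_k^lam / (2 lam)] for [k >= 1].  Integration by parts against the
weight makes the [P_k] orthogonal, and since [P_(k+1)' - P_(k-1)'] is a multiple
of [P_k], the inner product of [P_k'] and [P_l'] is [|P_(min k l)'|^2] when
[k - l] is even and [0] otherwise.  So the square of the Markov constant is the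
largest eigenvalue of a matrix [M] splitting into two parity blocks with
explicit entries.  It is bounded above by the Frobenius norm of [M], and below
by [tr (M^2) / tr M] on the block of even polynomials.  The traces telescope:
both [tr M] and the increments of [tr (M^2)] are rational functions of [n] and
[lam], and the two estimates reduce, by induction on [n] in steps of [2], to
polynomials with nonnegative coefficients. *)

(** * Polynomial inequalities *)

Section Bounds.
Variable R : realFieldType.
Implicit Types x y z : R.

(* Here [x] is a degree [k] and [y = 2 lam + 1].  [eig] is the diagonal entry
   [|P_k'|^2 / |P_k|^2] of [M]; [cumul] is the sum of [|P_l'|^4 / |P_l|^2] over
   [l <= k] of the parity of [k], divided by [|P_k'|^2]; [frob_step] is the
   increment of [tr (M^2)]; [upper] is the square of the upper bound, and [lower]
   is the lower bound times [tr M]. *)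
Definition eig x y := x * (2 * x + y - 1) * (x + y - 1) / y.
Definition cumul x y :=
  (x + y + 1) * (x + y) * (x * (x + y + 1) - 4 / (y + 2)) / (y * (y + 4)).
Definition frob_step x y := 2 * cumul x y * eig x y - eig x y ^+ 2.
Definition upper x y :=
  x ^+ 2 * (x + y - 1) ^+ 2 * (x + y + 1) ^+ 2 * (x + 2) * (x + y + 2)
  / (4 * y ^+ 2 * (y + 4)).
Definition lower x y :=
  x * (x + 2) ^+ 2 * (x + y - 1) ^+ 2 * (x + y + 1) * (x + y / 2) ^+ 2
  / (4 * y ^+ 2 * (y + 4)).

Ltac nonneg := repeat match goal with
  | |- is_true (0 <= _ + _) => apply: addr_ge0
  | |- is_true (0 <= _ * _) => apply: mulr_ge0
  | |- is_true (0 <= _ ^+ _) => apply: exprn_ge0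
  | |- is_true (0 <= _^-1) => rewrite invr_ge0
  end; rewrite ?ler0n ?ler01.

(** Expanding about degree 4 makes all coefficients nonnegative; about degree 2 some would be
    negative, so [frob_even_le] treats degree 2 separately. *)
Lemma frob_step_upper z y : 0 <= z -> 0 < y ->
  frob_step (z + 4) y <= upper (z + 4) y - upper (z + 2) y.
Proof.
move=> z0 y0; rewrite -subr_ge0.
have -> : upper (z + 4) y - upper (z + 2) y - frob_step (z + 4) y =
  (z + 4) * (z + 3 + y) / (4 * y ^+ 2 * (y + 4) * (y + 2)) * (
   (440 * y + 1348 * y ^+ 2 + 612 * y ^+ 3 + 92 * y ^+ 4 + 4 * y ^+ 5)
   + (1204 * y + 1966 * y ^+ 2 + 674 * y ^+ 3 + 74 * y ^+ 4 + 2 * y ^+ 5) * z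
   + (932 * y + 1002 * y ^+ 2 + 236 * y ^+ 3 + 14 * y ^+ 4) * z ^+ 2
   + (276 * y + 206 * y ^+ 2 + 26 * y ^+ 3) * z ^+ 3
   + (28 * y + 14 * y ^+ 2) * z ^+ 4).
  rewrite /upper /frob_step /cumul /eig; field.
  by rewrite !gt_eqF//; lra.
by nonneg; rewrite // ltW.
Qed.

(** The odd degree [z + 1] is paired with the increment of [upper] between the neighbouring even
    degrees, because both blocks must meet the same bound at an even [n]. *)
Lemma frob_step_upper_odd z y : 0 <= z -> 0 < y ->
  frob_step (z + 1) y <= upper (z + 2) y - upper z y.
Proof.
move=> z0 y0; rewrite -subr_ge0.
have -> : upper (z + 2) y - upper z y - frob_step (z + 1) y =
  (4 * y ^+ 2 * (y + 4) * (y + 2))^-1 * (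
   (1152 + 3936 * y + 5232 * y ^+ 2 + 3432 * y ^+ 3 + 1164 * y ^+ 4
      + 192 * y ^+ 5 + 12 * y ^+ 6)
   + (4800 + 13672 * y + 14932 * y ^+ 2 + 7936 * y ^+ 3 + 2136 * y ^+ 4
      + 272 * y ^+ 5 + 12 * y ^+ 6) * z
   + (8288 + 19396 * y + 17138 * y ^+ 2 + 7176 * y ^+ 3 + 1460 * y ^+ 4
      + 124 * y ^+ 5 + 2 * y ^+ 6) * z ^+ 2
   + (7680 + 14560 * y + 10128 * y ^+ 2 + 3184 * y ^+ 3 + 432 * y ^+ 4
      + 16 * y ^+ 5) * z ^+ 3
   + (4160 + 6240 * y + 3240 * y ^+ 2 + 680 * y ^+ 3 + 40 * y ^+ 4) * z ^+ 4
   + (1344 + 1480 * y + 500 * y ^+ 2 + 40 * y ^+ 3) * z ^+ 5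
   + (224 + 140 * y + 14 * y ^+ 2) * z ^+ 6).
  rewrite /upper /frob_step /cumul /eig; field.
  by rewrite !gt_eqF//; lra.
by nonneg; rewrite // ltW.
Qed.

Lemma frob_step_lower z y : 0 <= z -> 0 < y ->
  lower (z + 2) y - lower z y <= frob_step (z + 2) y.
Proof.
move=> z0 y0; rewrite -subr_ge0.
have -> : frob_step (z + 2) y - (lower (z + 2) y - lower z y) =
  (z + 2) * (z + 1 + y) / (4 * y ^+ 2 * (y + 4) * (y + 2)) * (
   (192 + 496 * y + 480 * y ^+ 2 + 220 * y ^+ 3 + 48 * y ^+ 4 + 4 * y ^+ 5)
   + (448 + 1064 * y + 809 * y ^+ 2 + 537 / 2 * y ^+ 3 + 40 * y ^+ 4
      + 5 / 2 * y ^+ 5) * z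
   + (376 + 764 * y + 397 * y ^+ 2 + 163 / 2 * y ^+ 3
      + 15 / 2 * y ^+ 4) * z ^+ 2
   + (156 + 202 * y + 56 * y ^+ 2 + 5 * y ^+ 3) * z ^+ 3
   + (28 + 14 * y) * z ^+ 4).
  rewrite /lower /frob_step /cumul /eig; field.
  by rewrite !gt_eqF//; lra.
by nonneg; rewrite // ltW.
Qed.

End Bounds.

(** * Quadratic forms with Gram matrix [S (min u v)] *)

Section MinGram.
Variables (R : realFieldType) (h S : nat -> R).
Hypothesis h_gt0 : forall u, 0 < h u.

(** If [f] is the sum of [a u] times orthogonal polynomials of squared norms [h u], then [wsum] is
    the squared norm of [f] and [quad] that of its derivative. [frob] is [tr (M^2)] for [M] with
    entries [S (minn u v) / sqrt (h u * h v)], written without roots. *)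
Definition wsum m (a : nat -> R) := \sum_(u < m) a u ^+ 2 * h u.
Definition quad m (a : nat -> R) :=
  \sum_(u < m) \sum_(v < m) a u * a v * S (minn u v).
Definition frob m :=
  \sum_(u < m) \sum_(v < m) S (minn u v) ^+ 2 / (h u * h v).

Lemma wsum_ge0 m a : 0 <= wsum m a.
Proof. by apply: sumr_ge0 => u _; rewrite mulr_ge0 ?sqr_ge0// ltW. Qed.

Lemma quad_eq0 m a : wsum m a = 0 -> quad m a = 0.
Proof.
move=> /psumr_eq0P H; rewrite /quad big1// => u _; rewrite big1// => v _.
have /eqP := H (fun i _ => mulr_ge0 (sqr_ge0 _) (ltW (h_gt0 _))) u isT.
by rewrite mulf_eq0 sqrf_eq0 (gt_eqF (h_gt0 u)) orbF => /eqP ->; rewrite !mul0r.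
Qed.

Lemma quad_le m a F : 0 < F -> frob m <= F ^+ 2 -> quad m a <= F * wsum m a.
Proof.
move=> F0 fF; have := wsum_ge0 m a.
rewrite le_eqVlt => /predU1P[/esym w0|w0]; first by rewrite quad_eq0// w0 mulr0.
(* This [t] balances the two terms of the estimate below: each is at most [F * wsum m a]. *)
pose t := wsum m a / F; have t0 : 0 < t by rewrite divr_gt0.
(* AM-GM: [2 a_u a_v S <= t S^2 / (h_u h_v) + a_u^2 a_v^2 h_u h_v / t]. *)
have : 2 * quad m a <= t * frob m + t^-1 * wsum m a ^+ 2.
  rewrite expr2 /wsum !mulr_sumr /quad -big_split/=; apply: ler_sum => u _.
  rewrite mulr_suml !mulr_sumr -big_split/=; apply: ler_sum => v _.
  have hu := h_gt0 u; have hv := h_gt0 v.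
  set s := S _; set x := a u; set y := a v.
  rewrite -subr_ge0.
  have -> : t * (s ^+ 2 / (h u * h v)) + t^-1 * (y ^+ 2 * h v * (x ^+ 2 * h u))
     - 2 * (x * y * s) = (t * s - x * y * h u * h v) ^+ 2 / (t * (h u * h v)).
    by field; rewrite !gt_eqF.
  apply: divr_ge0; first exact: sqr_ge0.
  exact/ltW/(mulr_gt0 t0 (mulr_gt0 hu hv)).
have -> : t^-1 * wsum m a ^+ 2 = F * wsum m a.
  by rewrite /t; field; rewrite !gt_eqF.
have : t * frob m <= F * wsum m a.
  apply: le_trans (ler_wpM2l (ltW t0) fF) _.
  by rewrite /t expr2 mulrA divfK ?gt_eqF// mulrC.
by lra.
Qed.

(** As [minn u m = u], the new row and the new column carry the same entries [S u]; only the corner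
    has [S m]. *)
Lemma frobS m : frob m.+1 =
  frob m + 2 * (\sum_(u < m) S u ^+ 2 / h u) / h m + (S m / h m) ^+ 2.
Proof.
rewrite /frob big_ord_recr/=.
under eq_bigr do rewrite big_ord_recr/=.
rewrite big_split/= big_ord_recr/= minnn -!addrA; congr (_ + _).
have e u : (u < m)%N -> S (minn u m) ^+ 2 / (h u * h m) = S u ^+ 2 / h u / h m.
  by move=> um; rewrite (minn_idPl (ltnW um)) invfM mulrA.
under eq_bigr do rewrite e//.
have -> : \sum_(v < m) S (minn m v) ^+ 2 / (h m * h v) =
    \sum_(v < m) S v ^+ 2 / h v / h m.
  by apply: eq_bigr => v _; rewrite minnC [h m * _]mulrC e.
by rewrite -mulr_suml addrA; congr (_ + _); [ring|rewrite expr_div_n expr2].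
Qed.

Hypothesis S0 : 0 <= S 0.
Hypothesis S_mono : forall u, S u <= S u.+1.

(* With [M = A^T A], the hypothesis is applied to the rows of [A] and summed:
   [tr (A M A^T) <= c tr (A A^T)]. *)
Lemma frob_le_trace m c : (forall a, quad m a <= c * wsum m a) ->
  frob m <= c * \sum_(u < m) S u / h u.
Proof.
move=> H.
(* [S (minn u v)] is the sum of [e j] over the [j] below both [u] and [v], so row [j] of [A] has
   entries [sqrt (e j) * (j <= u) / sqrt (h u)]. *)
pose e j := if j is i.+1 then S j - S i else S 0%N.
have e0 j : 0 <= e j by case: j => //= j; rewrite subr_ge0.
have Se u : S u = \sum_(j < u.+1) e j.
  elim: u => [|u IH]; first by rewrite big_ord1.
  by rewrite big_ord_recr/= -IH; ring.
have Sm u : (u < m)%N -> S u = \sum_(j < m) e j * (j <= u)%:R.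
  move=> um; rewrite Se (big_ord_widen m)// big_mkcond/=.
  by apply: eq_bigr => j _; rewrite ltnS; case: ifP; rewrite ?mulr1 ?mulr0.
(* Row [j] of [A] without [sqrt (e j)], in the coordinates of [quad] and [wsum], which brings in a
   second division by [sqrt (h u)]. *)
pose a j u := (j <= u)%:R / h u.
have -> : frob m = \sum_(j < m) e j * quad m (a j).
  under [RHS]eq_bigr do (rewrite mulr_sumr; under eq_bigr do rewrite mulr_sumr).
  rewrite [RHS]exchange_big; apply: eq_bigr => u _ /=.
  rewrite [RHS]exchange_big; apply: eq_bigr => v _ /=.
  have mm : (minn u v < m)%N by rewrite gtn_min ltn_ord.
  rewrite expr2 {1}(Sm _ mm) !mulr_suml; apply: eq_bigr => j _ /=.
  by rewrite leq_min -mulnb natrM /a; field; rewrite !gt_eqF.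
have -> : \sum_(u < m) S u / h u = \sum_(j < m) e j * wsum m (a j).
  under [RHS]eq_bigr do rewrite mulr_sumr.
  rewrite [RHS]exchange_big; apply: eq_bigr => u _ /=.
  rewrite (Sm u)// mulr_suml; apply: eq_bigr => j _.
  by rewrite /a; case: leqP => _ /=; field; rewrite !gt_eqF.
rewrite mulr_sumr; apply: ler_sum => j _.
by rewrite mulrCA ler_wpM2l.
Qed.

End MinGram.

(** * Closed form of the partial sums in one parity block *)

Section GegenbauerGram.
Variables (R : realFieldType) (x0 y : R) (h S : nat -> R).
Hypothesis x0_gt0 : 0 < x0.
Hypothesis x0E : cumul x0 y = eig x0 y.
Hypothesis y_gt0 : 0 < y.
Hypothesis h_gt0 : forall u, 0 < h u.
Hypothesis Sh : forall u, S u = eig (x0 + 2 * u%:R) y * h u.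
Hypothesis SS : forall u, let x := x0 + 2 * u%:R in
  x * (x + 1) * S u.+1 = (x + y) * (x + y + 1) * S u.

Let S_div_h u : S u / h u = eig (x0 + 2 * u%:R) y.
Proof. by rewrite Sh mulfK// gt_eqF. Qed.

(** Index [u] stands for degree [x0 + 2 u]. With [r = S m.+1 / S m], known from [SS], the induction
    step is the rational identity [r * cumul (x + 2) y = cumul x y + r * eig (x + 2) y]; [x0E] is
    the base case. *)
Lemma cumul_sum m :
  \sum_(u < m.+1) S u ^+ 2 / h u = S m * cumul (x0 + 2 * m%:R) y.
Proof.
elim: m => [|m IH].
  rewrite big_ord1 expr2 -mulrA S_div_h /= mulr0 addr0 x0E; ring.
rewrite big_ord_recr/= IH expr2 -mulrA S_div_h -[m.+1%:R]natr1.
have := SS m; set x := x0 + 2 * m%:R => /= H.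
have -> : x0 + 2 * (m%:R + 1) = x + 2 by rewrite /x; ring.
have x_gt0 : 0 < x by have : 0 <= m%:R :> R by []; rewrite /x; move: x0_gt0; lra.
have -> : S m.+1 = (x + y) * (x + y + 1) / (x * (x + 1)) * S m.
  apply: (mulfI (_ : x * (x + 1) != 0)).
    by rewrite gt_eqF// mulr_gt0//; lra.
  by rewrite H; field; rewrite !gt_eqF//; lra.
by rewrite /cumul /eig; field; move: y_gt0 => ?; rewrite !gt_eqF//; lra.
Qed.

(** [cumul_sum] includes the index [m] while the sum in [frobS] stops before it, so the increment is
    [2 * (cumul - eig) * eig + eig ^+ 2]. *)
Lemma frob_frob_step m : frob h S m.+1 = frob h S m + frob_step (x0 + 2 * m%:R) y.
Proof.
have := cumul_sum m; rewrite big_ord_recr/= => /(canRL (addrK _)) e.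
by rewrite frobS e Sh /frob_step; field; rewrite gt_eqF.
Qed.

Lemma S_ge0 u : 1 <= x0 -> 0 <= S u.
Proof.
move=> x1; have u0 : 0 <= u%:R :> R by [].
rewrite Sh /eig mulr_ge0 ?(ltW (h_gt0 u))// divr_ge0 ?(ltW y_gt0)//.
by move: y_gt0 => ?; rewrite !mulr_ge0//; lra.
Qed.

Lemma S_nondecreasing u : 1 <= x0 -> S u <= S u.+1.
Proof.
move=> x1; have u0 : 0 <= u%:R :> R by [].
have /= := SS u; set x := _ + _ => H.
have x_ge1 : 1 <= x by rewrite /x; lra.
have c0 : 0 < x * (x + 1) by rewrite mulr_gt0//; lra.
rewrite -(ler_pM2l c0) H ler_wpM2r ?S_ge0//.
by move: y_gt0 => ?; rewrite ler_pM//; lra.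
Qed.

End GegenbauerGram.

(** * Trace estimates for the odd and the even block *)

Section Estimates.
Variables (R : realFieldType) (y : R) (h S : nat -> R).
Hypothesis y_gt0 : 0 < y.

(** Degrees 1 and 2 start the two blocks, and there the sum behind [cumul] has a single term. One
    closed form fits both parities. *)
Lemma cumul1 : cumul 1 y = eig 1 y.
Proof. by rewrite /cumul /eig; field; move: y_gt0 => ?; rewrite !gt_eqF//; lra. Qed.

Lemma cumul2 : cumul 2 y = eig 2 y.
Proof. by rewrite /cumul /eig; field; move: y_gt0 => ?; rewrite !gt_eqF//; lra. Qed.

Lemma frob_odd_le m :
  (forall u, frob h S u.+1 = frob h S u + frob_step (1 + 2 * u%:R) y) ->
  frob h S m <= upper (2 * m%:R) y.
Proof.
move=> H; elim: m => [|m IH].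
  by rewrite /frob big_ord0 /upper mulr0 expr0n/= !mul0r.
rewrite H -[m.+1%:R]natr1 mulrDr mulr1 [1 + _]addrC.
have := @frob_step_upper_odd _ (2 * m%:R) y (mulr_ge0 (ler0n _ _) (ler0n _ _)) y_gt0.
by lra.
Qed.

Lemma frob_even_le m :
  (forall u, frob h S u.+1 = frob h S u + frob_step (2 + 2 * u%:R) y) ->
  frob h S m <= upper (2 * m%:R) y.
Proof.
move=> H; case: m => [|m].
  by rewrite /frob big_ord0 /upper mulr0 expr0n/= !mul0r.
elim: m => [|m IH].
  (* At degree 2 [frob_step] and [upper] agree, so the induction starts from an equality. *)
  rewrite H /frob big_ord0 add0r mulr0 addr0 mulr1 le_eqVlt; apply/predU1P; left.
  rewrite /frob_step cumul2 /eig /upper.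
  by field; move: y_gt0 => ?; rewrite !gt_eqF//; lra.
rewrite H; move: IH; rewrite -[m.+2%:R]natr1 -[m.+1%:R]natr1.
have -> : 2 * (m%:R + 1 + 1) = 2 * m%:R + 4 :> R by ring.
have -> : 2 + 2 * (m%:R + 1) = 2 * m%:R + 4 :> R by ring.
have -> : 2 * (m%:R + 1) = 2 * m%:R + 2 :> R by ring.
have := @frob_step_upper _ (2 * m%:R) y (mulr_ge0 (ler0n _ _) (ler0n _ _)) y_gt0.
by lra.
Qed.

Lemma frob_even_ge m :
  (forall u, frob h S u.+1 = frob h S u + frob_step (2 + 2 * u%:R) y) ->
  lower (2 * m%:R) y <= frob h S m.
Proof.
move=> H; elim: m => [|m IH].
  by rewrite /frob big_ord0 /lower mulr0 !mul0r.
rewrite H -[m.+1%:R]natr1 mulrDr mulr1 [2 + _]addrC.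
have := @frob_step_lower _ (2 * m%:R) y (mulr_ge0 (ler0n _ _) (ler0n _ _)) y_gt0.
by lra.
Qed.

(** This is the trace of [M] on the even block, the factor between [lower] and the lower bound
    sought. *)
Lemma sum_eig m : \sum_(u < m) eig (2 + 2 * u%:R) y =
  (2 * m%:R) * (2 * m%:R + 2) * (2 * m%:R + y - 1) * (2 * m%:R + y + 1) / (4 * y).
Proof.
elim: m => [|m IH]; first by rewrite big_ord0 mulr0 !mul0r.
rewrite big_ord_recr/= IH -[m.+1%:R]natr1 /eig; field.
by move: y_gt0 => ?; rewrite !gt_eqF//; lra.
Qed.

End Estimates.

(** * Gegenbauer polynomials *)

(* [gegenbauer lam i] is [C_(i+1)^lam / (2 lam)]: dividing by [2 lam] keeps the
   recurrence meaningful at [lam = 0], at the price of leaving out degree [0]. *)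
Fixpoint gegen_rec (R : realFieldType) (lam : R) (i : nat) : {poly R} :=
  match i with
  | 0 => 'X
  | j.+1 => match j with
    | 0 => (1 + lam)%:P * 'X^2 - (2^-1)%:P
    | k.+1 => (2 * (k.+2%:R + lam) / k.+3%:R)%:P * 'X * gegen_rec lam j
              - ((k.+1%:R + 2 * lam) / k.+3%:R)%:P * gegen_rec lam k
    end
  end.

HB.lock Definition gegenbauer (R : realFieldType) (lam : R) i := gegen_rec lam i.

Section Gegenbauer.
Variables (R : realFieldType) (lam : R).
Local Notation gegen := (gegenbauer lam).

Lemma gegen0 : gegen 0 = 'X. Proof. by rewrite unlock. Qed.

Lemma gegen1 : gegen 1 = (1 + lam)%:P * 'X^2 - (2^-1)%:P.
Proof. by rewrite unlock. Qed.

Lemma gegenSS_def i : gegen i.+2 =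
  (2 * (i.+2%:R + lam) / i.+3%:R)%:P * 'X * gegen i.+1
  - ((i.+1%:R + 2 * lam) / i.+3%:R)%:P * gegen i.
Proof. by rewrite unlock. Qed.

(** Index [i] has degree [i + 1]: this is the three-term recurrence centred at degree [i + 2],
    cleared of denominators. *)
Lemma gegenSS i : (i%:R + 3)%:P * gegen i.+2 =
  (2 * (i%:R + 2 + lam))%:P * 'X * gegen i.+1
  - (i%:R + 1 + 2 * lam)%:P * gegen i.
Proof.
have E c g : (i%:R + 3)%:P * ((c / i.+3%:R)%:P * g) = c%:P * g :> {poly R}.
  by rewrite mulrA -polyCM mulrCA -natrD addn3 divff ?mulr1 ?pnatr_eq0.
by rewrite gegenSS_def mulrBr -(mulrA _ 'X) !E -!natr1; ring.
Qed.

(** The two classical derivative relations carry each other through the induction: the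
    differentiated recurrence yields the second one at the next index, and this with the recurrence
    yields the first. *)
Lemma deriv_gegen i :
  'X * (gegen i.+1)^`() - (gegen i)^`() = (i%:R + 2)%:P * gegen i.+1 /\
  (gegen i.+1)^`() = 'X * (gegen i)^`() + (i%:R + 1 + 2 * lam)%:P * gegen i.
Proof.
elim: i => [|i [A B]].
  have e2 : (0 + 2)%:P * (2^-1)%:P = 1 :> {poly R}.
    by rewrite -polyCM add0r divff ?pnatr_eq0.
  by rewrite gegen1 gegen0 !poly.derivE; split;
    rewrite ?[in RHS]mulrBr ?e2; ring.
have i3n : (i%:R + 3)%:P != 0 :> {poly R}.
  by rewrite polyC_eq0 -natrD pnatr_eq0 addnS.
have r := gegenSS i; have := congr1 (@deriv R) r; rewrite !poly.derivE => r'.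
have A' : (gegen i)^`() = 'X * (gegen i.+1)^`() - (i%:R + 2)%:P * gegen i.+1.
  by rewrite -A; ring.
have B' : (gegen i.+2)^`() =
    'X * (gegen i.+1)^`() + (i.+1%:R + 1 + 2 * lam)%:P * gegen i.+1.
  by apply: (mulfI i3n); rewrite r' A' -natr1; ring.
have B0 : (i%:R + 1 + 2 * lam)%:P * gegen i = (gegen i.+1)^`() - 'X * (gegen i)^`().
  by rewrite B; ring.
split => //; rewrite B' -natr1.
have -> : i%:R + 1 + 2 = i%:R + 3 :> R by ring.
by rewrite r B0 A'; ring.
Qed.

(** The derivative of [gegen i.+1] is eliminated between the relations of [deriv_gegen] at two
    consecutive indices. *)
Lemma deriv_gegenSS i : (gegen i.+2)^`() =
  (gegen i)^`() + (2 * (i%:R + 2 + lam))%:P * gegen i.+1.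
Proof.
rewrite (deriv_gegen i.+1).2 -natr1.
have <- : 'X * (gegen i.+1)^`() - (i%:R + 2)%:P * gegen i.+1 = (gegen i)^`().
  by rewrite -(deriv_gegen i).1; ring.
by ring.
Qed.

Lemma gegen_ladder i : (1 - 'X^2) * (gegen i)^`() =
  (i%:R + 1 + 2 * lam)%:P * 'X * gegen i - (i%:R + 2)%:P * gegen i.+1.
Proof. by rewrite -(deriv_gegen i).1 (deriv_gegen i).2; ring. Qed.

(** Differentiate [gegen_ladder] and remove the derivative of [gegen i.+1] by the second relation of
    [deriv_gegen]. *)
Lemma gegen_ode i :
  (1 - 'X^2) * (gegen i)^`()^`() - (2 * lam + 1)%:P * 'X * (gegen i)^`() =
  - ((i%:R + 1) * (i%:R + 1 + 2 * lam))%:P * gegen i.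
Proof.
have := congr1 (@deriv R) (gegen_ladder i).
rewrite !poly.derivE (deriv_gegen i).2 /= expr1 => H.
have -> : (1 - 'X^2) * (gegen i)^`()^`() =
  (0 - 'X *+ 2) * (gegen i)^`() + (1 - 'X^2) * (gegen i)^`()^`()
    + 2%:P * 'X * (gegen i)^`() by ring.
by rewrite H; ring.
Qed.

Hypothesis lam_gt : -(2^-1) < lam.

Lemma size_gegen i : size (gegen i) = i.+2.
Proof.
suff [] : size (gegen i) = i.+2 /\ size (gegen i.+1) = i.+3 by [].
have sX (c : R) (p : {poly R}) k : c != 0 -> size p = k.+1 ->
    size (c%:P * 'X * p) = k.+2.
  move=> c0 sp; have p0 : p != 0 by rewrite -size_poly_eq0 sp.
  by rewrite -mulrA size_Cmul// mulrC size_mulX// sp.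
have szC (c : R) (p : {poly R}) : (size (- (c%:P * p)) <= size p)%N.
  by rewrite size_polyN mul_polyC size_scale_leq.
have l1 : 1 + lam != 0 by apply: lt0r_neq0; move: lam_gt; lra.
elim: i => [|i [IH1 IH2]]; split => //.
- by rewrite gegen0 size_polyX.
- rewrite gegen1 -['X^2]/('X * 'X) mulrA size_polyDl.
    by rewrite (sX _ _ 1%N)// size_polyX.
  rewrite (sX _ _ 1%N)// ?size_polyX// size_polyN.
  exact: leq_ltn_trans (size_polyC_leq1 _) _.
rewrite gegenSS_def.
have c0 : 2 * (i.+2%:R + lam) / i.+3%:R != 0.
  rewrite mulf_neq0 ?invr_eq0 ?pnatr_eq0// mulf_neq0 ?pnatr_eq0//.
  by apply: lt0r_neq0; have : 0 <= i%:R :> R by []; rewrite -!natr1; move: lam_gt; lra.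
rewrite size_polyDl; first exact: sX c0 IH2.
rewrite (sX _ _ _ c0 IH2); apply: leq_ltn_trans (szC _ _) _.
by rewrite IH1.
Qed.

(* [LE] is integration by parts for [L p = int w p]; it determines [L] up to the
   factor [L 1]. *)
Variable L : {scalar {poly R}}.
Hypothesis L1_gt0 : 0 < L 1.
Hypothesis LE : forall q : {poly R},
  L ((1 - 'X^2) * q^`()) = (2 * lam + 1) * L ('X * q).

Let LC c p : L (c%:P * p) = c * L p.
Proof. by rewrite mul_polyC linearZ. Qed.

Let ev i : R := (i%:R + 1) * (i%:R + 1 + 2 * lam).

Let ev_gt0 i : 0 < ev i.
Proof.
by have ? : 0 <= i%:R :> R by []; rewrite mulr_gt0//; move: lam_gt; lra.
Qed.

(** Weak form of the differential equation: [LE] is applied to [q] times the derivative of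
    [gegen i]. *)
Let LE_gegen i (q : {poly R}) :
  ev i * L (gegen i * q) = L ((1 - 'X^2) * (gegen i)^`() * q^`()).
Proof.
have := LE ((gegen i)^`() * q); rewrite -LC => /eqP.
rewrite -subr_eq0 -linearB /= derivM => /eqP H.
apply/eqP; rewrite eq_sym -subr_eq0 -LC -linearB -[X in _ == X]H; apply/eqP.
have ode : (ev i)%:P * gegen i =
    - ((1 - 'X^2) * (gegen i)^`()^`() - (2 * lam + 1)%:P * 'X * (gegen i)^`()).
  by rewrite gegen_ode mulNr opprK.
by congr (L _); rewrite [(ev i)%:P * _]mulrA ode; ring.
Qed.

(** Orthogonality to degree 0, which the family leaves out: the test function in [LE_gegen] is 1. *)
Lemma L_gegen i : L (gegen i) = 0.
Proof.
have := LE_gegen i 1; rewrite derivC mulr0 linear0 mulr1 => /eqP.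
by rewrite mulf_eq0 gt_eqF//= => /eqP.
Qed.

(** The right-hand side of [LE_gegen] is symmetric for two members of the family, while their
    eigenvalues [ev] differ. *)
Lemma gegen_orth i j : i != j -> L (gegen i * gegen j) = 0.
Proof.
move=> ij; have h1 := LE_gegen i (gegen j); have := LE_gegen j (gegen i).
rewrite [in RHS]mulrAC -h1 [gegen j * _]mulrC => /eqP.
rewrite -subr_eq0 -mulrBl mulf_eq0 => /orP[|/eqP//].
have -> : ev j - ev i = (j%:R - i%:R) * (i%:R + j%:R + 2 + 2 * lam).
  by rewrite /ev; ring.
rewrite mulf_eq0 subr_eq0 eqr_nat eq_sym (negbTE ij)/= gt_eqF//.
have ? : 0 <= i%:R :> R by []. have ? : 0 <= j%:R :> R by [].
by move: lam_gt; lra.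
Qed.

(** By [deriv_gegenSS] the derivative is a combination of a constant or ['X] and of members of lower
    degree; hence two base cases and steps of 2. *)
Lemma gegen_orth_deriv i j : (j <= i)%N -> L (gegen i * (gegen j)^`()) = 0.
Proof.
suff : ((j <= i)%N -> L (gegen i * (gegen j)^`()) = 0) /\
       ((j.+1 <= i)%N -> L (gegen i * (gegen j.+1)^`()) = 0) by case.
elim: j => [|j [IH1 IH2]].
  split; first by rewrite gegen0 derivX mulr1 L_gegen.
  rewrite (deriv_gegen 0).2 gegen0 derivX mulr1 mulrDr linearD/= => i0.
  by rewrite mulrCA LC -gegen0 gegen_orth -?lt0n// mulr0 addr0.
split => [|ji]; first exact: IH2.
rewrite deriv_gegenSS mulrDr linearD/= IH1; last first.
  exact: ltnW (ltnW ji).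
by rewrite mulrCA LC gegen_orth ?mulr0 ?addr0// gtn_eqF.
Qed.

Definition gegen_sqn i := L (gegen i ^+ 2).
Definition gegen_dsqn i := L ((gegen i)^`() ^+ 2).

(** Raising the larger index by 2 adds a multiple of a member of the family that is orthogonal to
    the derivative of [gegen i]. Hence the Gram entry depends on the smaller index only. *)
Lemma gegen_deriv_gram i k :
  L ((gegen (i + k.*2))^`() * (gegen i)^`()) = gegen_dsqn i.
Proof.
elim: k => [|k IH]; first by rewrite addn0.
rewrite doubleS !addnS deriv_gegenSS mulrDl linearD/= IH -mulrA LC.
by rewrite gegen_orth_deriv ?mulr0 ?addr0// leqW// leq_addr.
Qed.

(** [deriv_gegenSS] shrinks the gap by 2; at gap 1 it lowers the degree instead, down to the
    derivative of [gegen 1], a multiple of ['X], against a constant. *)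
Lemma gegen_deriv_gram_odd i k :
  L ((gegen (i + k.*2.+1))^`() * (gegen i)^`()) = 0.
Proof.
elim: k => [|k IH]; last first.
  rewrite doubleS !addnS deriv_gegenSS mulrDl linearD/= -addnS IH -mulrA LC.
  by rewrite gegen_orth_deriv ?mulr0 ?addr0// -!addnS leq_addr.
rewrite addn1; elim: i => [|i IH].
  rewrite (deriv_gegen 0).2 gegen0 derivX !mulr1 linearD/= LC.
  by rewrite -gegen0 L_gegen mulr0 addr0.
rewrite deriv_gegenSS mulrDl linearD/= mulrC IH -mulrA LC.
by rewrite gegen_orth_deriv// mulr0 addr0.
Qed.

(** The square of the derivative is split by [1 = (1 - x^2) + x^2]. [LE_gegen] evaluates the first
    part; for the second, [LE] is applied to ['X] times that square and the differential equation
    removes the second derivative. *)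
Lemma gegen_dsqnE i : gegen_dsqn i =
  2 * (i%:R + 1) * (i%:R + 1 + lam) * (i%:R + 1 + 2 * lam) / (2 * lam + 1) * gegen_sqn i.
Proof.
set g := gegen i.
have l0 : 2 * lam + 1 != 0 by apply: lt0r_neq0; move: lam_gt; lra.
(* [x g' = (i + 1) g] up to a term orthogonal to [g]. *)
have Lx : L ('X * g^`() * g) = (i%:R + 1) * gegen_sqn i.
  rewrite /g; case: i {g} => [|i].
    by rewrite /gegen_sqn gegen0 derivX mulr1 add0r mul1r.
  have -> : 'X * (gegen i.+1)^`() = (i%:R + 2)%:P * gegen i.+1 + (gegen i)^`().
    by rewrite -(deriv_gegen i).1; ring.
  rewrite mulrDl linearD/= -mulrA LC [(gegen i)^`() * _]mulrC.
  by rewrite gegen_orth_deriv ?leqnSn// addr0 -natr1 /gegen_sqn; congr (_ * _); ring.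
have L1 : L ((1 - 'X^2) * g^`() ^+ 2) = ev i * gegen_sqn i.
  by rewrite /gegen_sqn expr2 mulrA -LE_gegen expr2.
have : (2 * lam + 1) * L ('X^2 * g^`() ^+ 2) = ev i * (2 * i%:R + 1) * gegen_sqn i.
  have := LE ('X * g^`() ^+ 2).
  have -> : (1 - 'X^2) * ('X * g^`() ^+ 2)^`() =
    (1 - 'X^2) * g^`() ^+ 2 +
      2%:P * ('X * g^`() * ((1 - 'X^2) * g^`()^`())) by rewrite !poly.derivE; ring.
  have -> : (1 - 'X^2) * g^`()^`() =
    (2 * lam + 1)%:P * 'X * g^`() - (ev i)%:P * g.
    by have := gegen_ode i; rewrite -/g -/(ev i) => /(canRL (subrK _)) ->; ring.
  have -> : 'X * g^`() * ((2 * lam + 1)%:P * 'X * g^`() - (ev i)%:P * g) =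
    (2 * lam + 1)%:P * ('X^2 * g^`() ^+ 2) - (ev i)%:P * ('X * g^`() * g) by ring.
  rewrite linearD/= L1 LC linearB/= !LC Lx.
  have -> : 'X * ('X * g^`() ^+ 2) = 'X^2 * g^`() ^+ 2 by ring.
  by move=> H; nra.
have -> : gegen_dsqn i = L ((1 - 'X^2) * g^`() ^+ 2) + L ('X^2 * g^`() ^+ 2).
  by rewrite -linearD/=; congr (L _); ring.
rewrite L1 => H.
apply: (mulfI l0); rewrite mulrDr H /ev; field.
exact: l0.
Qed.

(** The mixed moment [m] is computed twice: from the recurrence paired with [gegen i], and from the
    recurrence one index lower paired with [gegen i.+1]. *)
Lemma gegen_sqnS i : (i%:R + 2) * (i%:R + 2 + lam) * gegen_sqn i.+1 =
  (i%:R + 1 + lam) * (i%:R + 1 + 2 * lam) * gegen_sqn i.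
Proof.
pose m := L ('X * gegen i * gegen i.+1).
have e1 : 2 * (i%:R + 2 + lam) * m = (i%:R + 1 + 2 * lam) * gegen_sqn i.
  have : L ((i%:R + 3)%:P * gegen i.+2 * gegen i) = 0.
    by rewrite -mulrA LC gegen_orth ?mulr0// gtn_eqF// leqW.
  rewrite gegenSS => /eqP; rewrite mulrBl linearB/= subr_eq0 -!mulrA !LC => /eqP.
  rewrite /gegen_sqn expr2 /m => <-.
  have -> : 'X * gegen i * gegen i.+1 = 'X * (gegen i.+1 * gegen i) by ring.
  by ring.
have e2 : (i%:R + 2) * gegen_sqn i.+1 = 2 * (i%:R + 1 + lam) * m.
  rewrite /m /gegen_sqn; case: i {m e1} => [|i].
    rewrite expr2 {1}gegen1 mulrBl linearB/= LC L_gegen mulr0 subr0 -(mulrA _ 'X^2) LC.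
    by rewrite gegen0 expr2; ring.
  have := congr1 (fun p => L (p * gegen i.+2)) (gegenSS i).
  rewrite mulrBl linearB/= -!mulrA !LC (@gegen_orth i i.+2) ?mulr0 ?subr0; last first.
    by rewrite ltn_eqF// leqW.
  rewrite -[i.+1%:R]natr1 expr2 => H.
  have -> : i%:R + 1 + 2 = i%:R + 3 :> R by ring.
  by rewrite H; ring.
have -> : (i%:R + 2) * (i%:R + 2 + lam) * gegen_sqn i.+1 =
  (i%:R + 2 + lam) * ((i%:R + 2) * gegen_sqn i.+1) by ring.
rewrite e2.
have -> : (i%:R + 2 + lam) * (2 * (i%:R + 1 + lam) * m) =
  (i%:R + 1 + lam) * (2 * (i%:R + 2 + lam) * m) by ring.
by rewrite e1; ring.
Qed.

Lemma gegen_dsqnS i : (i%:R + 1) * gegen_dsqn i.+1 =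
  (i%:R + 1 + (2 * lam + 1)) * gegen_dsqn i.
Proof.
have -> : gegen_dsqn i.+1 = 2 * (i%:R + 2 + 2 * lam) / (2 * lam + 1)
    * ((i%:R + 2) * (i%:R + 2 + lam) * gegen_sqn i.+1).
  by rewrite gegen_dsqnE -[i.+1%:R]natr1; ring.
by rewrite gegen_sqnS gegen_dsqnE; ring.
Qed.

(** [LE] at ['X] gives [(2 lam + 2) * L ('X^2) = L 1], and [gegen_sqnS] propagates the sign. *)
Lemma gegen_sqn_gt0 i : 0 < gegen_sqn i.
Proof.
elim: i => [|i IH].
  have := LE 'X; rewrite derivX mulr1 linearB/= -expr2 /gegen_sqn gegen0 => H.
  rewrite ltNge; apply/negP => H2; move: lam_gt L1_gt0 => h1 h3.
  by nra.
have i0 : 0 <= i%:R :> R by [].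
have := gegen_sqnS i; move: lam_gt => l0 H.
have : 0 < (i%:R + 2) * (i%:R + 2 + lam) * gegen_sqn i.+1.
  by rewrite H mulr_gt0// mulr_gt0//; lra.
by rewrite pmulr_rgt0// mulr_gt0//; lra.
Qed.

End Gegenbauer.

(** * The Markov inequality for an abstract Gegenbauer functional *)

Section MarkovForm.
Variables (R : realFieldType) (lam : R).
Hypothesis lam_gt : -(2^-1) < lam.
Variable L : {scalar {poly R}}.
Hypothesis L1_gt0 : 0 < L 1.
Hypothesis LE : forall q : {poly R},
  L ((1 - 'X^2) * q^`()) = (2 * lam + 1) * L ('X * q).
Local Notation gegen := (gegenbauer lam).
Local Notation y := (2 * lam + 1).

Let y_gt0 : 0 < y. Proof. by move: lam_gt; lra. Qed.

Let LC c p : L (c%:P * p) = c * L p.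
Proof. by rewrite mul_polyC linearZ. Qed.

Lemma gegen_span i (p : {poly R}) : (size p <= i.+2)%N ->
  exists c, (size (p - c%:P * gegen i)%R <= i.+1)%N.
Proof.
move=> sp; have sg := size_gegen lam_gt i.
have g0 : (gegen i)`_i.+1 != 0.
  have -> : (gegen i)`_i.+1 = lead_coef (gegen i) by rewrite lead_coefE sg.
  by rewrite lead_coef_eq0 -size_poly_eq0 sg.
exists (p`_i.+1 / (gegen i)`_i.+1); apply/leq_sizeP => j.
rewrite leq_eqVlt => /predU1P[<-|ij]; rewrite coefB coefCM.
  by rewrite divfK// subrr.
by rewrite (nth_default _ (leq_trans sp ij)) [(gegen i)`_j]nth_default ?sg// mulr0 subr0.
Qed.

(** Since [gegen k] has degree [k + 1], [e = 1] collects the even degrees from 2 to [2 m] and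
    [e = 0] the odd degrees from 1 to [2 m - 1]. *)
Definition gsum (e m : nat) (a : nat -> R) : {poly R} :=
  \sum_(u < m) (a u)%:P * gegen (u.*2 + e).

Lemma gegen_decomp m (p : {poly R}) : (size p <= m.*2.+1)%N ->
  exists c a b, p = c%:P + gsum 1 m a + gsum 0 m b.
Proof.
elim: m p => [|m IH] p sp.
  exists p`_0, (fun=> 0), (fun=> 0).
  by rewrite /gsum !big_ord0 !addr0 -size1_polyC.
have [al s1] := gegen_span sp.
have [be s2] := gegen_span s1.
have [c [a [b e]]] := IH _ s2.
exists c, (fun u => if u == m then al else a u), (fun u => if u == m then be else b u).
rewrite /gsum !big_ord_recr/= eqxx addn1 addn0.
under eq_bigr do rewrite ltn_eqF//.
under [X in _ + (X + _)]eq_bigr do rewrite ltn_eqF//.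
move: e; rewrite /gsum => /(canRL (subrK _)) /(canRL (subrK _)) ->.
by ring.
Qed.

Lemma size_gsum e m a : (e <= 1)%N -> (size (gsum e m a) <= m.*2.+1)%N.
Proof.
move=> e1; apply: (leq_trans (size_sum _ _ _)); apply/bigmax_leqP => u _.
rewrite mul_polyC; apply: leq_trans (size_scale_leq _ _) _.
rewrite size_gegen// ltnS -addnS; apply: (@leq_trans (u.*2 + 2)).
  by rewrite leq_add2l.
by rewrite addn2 -doubleS leq_double.
Qed.

Lemma L_sum_mul m (a b : nat -> R) (f g : nat -> {poly R}) :
  L ((\sum_(u < m) (a u)%:P * f u) * (\sum_(v < m) (b v)%:P * g v)) =
  \sum_(u < m) \sum_(v < m) a u * b v * L (f u * g v).
Proof.
rewrite mulr_suml linear_sum; apply: eq_bigr => u _ /=.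
rewrite mulr_sumr linear_sum; apply: eq_bigr => v _ /=.
by rewrite mulrACA -polyCM LC.
Qed.

Lemma deriv_gsum e m a :
  (gsum e m a)^`() = \sum_(u < m) (a u)%:P * (gegen (u.*2 + e))^`().
Proof.
rewrite /gsum raddf_sum/=; apply: eq_bigr => u _.
by rewrite derivM derivC mul0r add0r.
Qed.

Let h e u := gegen_sqn lam L (u.*2 + e).
Let S e u := gegen_dsqn lam L (u.*2 + e).

Lemma L_gsum_sqr e m a : L (gsum e m a ^+ 2) = wsum (h e) m a.
Proof.
rewrite expr2 /gsum.
rewrite (L_sum_mul m a a (fun u => gegen (u.*2 + e)) (fun u => gegen (u.*2 + e))).
apply: eq_bigr => u _; rewrite (bigD1 u)//= big1 ?addr0 => [|v vu].
  by rewrite -!expr2.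
rewrite (gegen_orth lam_gt LE) ?mulr0// eqn_add2r.
by rewrite (inj_eq double_inj) eq_sym; exact: vu.
Qed.

Lemma L_deriv_gsum_sqr e m a : L ((gsum e m a)^`() ^+ 2) = quad (S e) m a.
Proof.
rewrite expr2 deriv_gsum.
rewrite (L_sum_mul m a a (fun u => (gegen (u.*2 + e))^`())
  (fun u => (gegen (u.*2 + e))^`())).
apply: eq_bigr => u _; apply: eq_bigr => v _; congr (_ * _).
have G i k : (i <= k)%N -> L ((gegen (k.*2 + e))^`() * (gegen (i.*2 + e))^`()) = S e i.
  move=> ik; rewrite -(subnKC ik) doubleD -addnAC.
  exact: (gegen_deriv_gram lam_gt LE).
case: (leqP u v) => [uv|/ltnW vu]; last exact: G.
by rewrite mulrC G.
Qed.

Lemma L_gsum_orth m a b : L (gsum 1 m a * gsum 0 m b) = 0.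
Proof.
rewrite /gsum (L_sum_mul m a b (fun u => gegen (u.*2 + 1))
  (fun u => gegen (u.*2 + 0))).
rewrite big1// => u _; rewrite big1// => v _.
rewrite (gegen_orth lam_gt LE) ?mulr0//; apply/eqP => /(congr1 odd).
by rewrite !oddD !odd_double.
Qed.

Lemma L_deriv_gsum_orth m a b : L ((gsum 1 m a)^`() * (gsum 0 m b)^`()) = 0.
Proof.
rewrite !deriv_gsum.
rewrite (L_sum_mul m a b (fun u => (gegen (u.*2 + 1))^`())
  (fun u => (gegen (u.*2 + 0))^`())).
rewrite big1// => u _; rewrite big1// => v _.
suff -> : L ((gegen (u.*2 + 1))^`() * (gegen (v.*2 + 0))^`()) = 0 by rewrite mulr0.
rewrite addn1 addn0; case: (leqP v u) => [vu|uv].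
  have -> : u.*2.+1 = (v.*2 + (u - v).*2.+1)%N by rewrite addnS -doubleD subnKC.
  exact: (gegen_deriv_gram_odd lam_gt LE).
have -> : v.*2 = (u.*2.+1 + (v - u.+1).*2.+1)%N.
  by rewrite addSn addnS -doubleD -addn2 -(doubleD _ 1) addnAC addn1 subnKC.
by rewrite mulrC; exact: (gegen_deriv_gram_odd lam_gt LE).
Qed.

Lemma L_gsum e m a : L (gsum e m a) = 0.
Proof.
by rewrite linear_sum big1// => u _ /=; rewrite LC (L_gegen lam_gt LE) mulr0.
Qed.

Let h_gt0 e u : 0 < h e u.
Proof. exact: gegen_sqn_gt0. Qed.

Let idx e u : (u.*2 + e)%:R + 1 = e.+1%:R + 2 * u%:R :> R.
Proof. by rewrite natrD -muln2 natrM -[e.+1%:R]natr1; ring. Qed.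

Let ShE e u : S e u = eig (e.+1%:R + 2 * u%:R) y * h e u.
Proof.
rewrite /S (gegen_dsqnE lam_gt LE) idx /eig /h; ring.
Qed.

(** One step in [u] is two steps in degree, so [gegen_dsqnS] is used twice. *)
Let SSE e u : let x := e.+1%:R + 2 * u%:R in
  x * (x + 1) * S e u.+1 = (x + y) * (x + y + 1) * S e u.
Proof.
move=> x; have h1 := gegen_dsqnS lam_gt LE (u.*2 + e).
have h2 := gegen_dsqnS lam_gt LE (u.*2 + e).+1.
move: h1 h2; rewrite -[(u.*2 + e).+1%:R]natr1 idx -/x /S doubleS !addSn => h1 h2.
rewrite -mulrA h2 [x * _]mulrCA h1; ring.
Qed.

Let frobE e m : (e <= 1)%N -> frob (h e) (S e) m.+1 =
  frob (h e) (S e) m + frob_step (e.+1%:R + 2 * m%:R) y.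
Proof.
move=> e1; apply: (frob_frob_step _ _ y_gt0 (h_gt0 e) (ShE e) (SSE e)) => //.
by case: e e1 => [|[|//]] _; [exact: cumul1|exact: cumul2].
Qed.

(** The constant, even and odd parts of [p] are mutually orthogonal, and so are the derivatives of
    the last two. Each block is bounded by its Frobenius norm; the constant only enlarges the
    right-hand side. *)
Lemma markov_upper m (p : {poly R}) F : 0 < F -> upper (2 * m%:R) y <= F ^+ 2 ->
  (size p <= m.*2.+1)%N -> L (p^`() ^+ 2) <= F * L (p ^+ 2).
Proof.
move=> F0 UF /gegen_decomp[c [a [b ->]]].
have -> : (c%:P + gsum 1 m a + gsum 0 m b)^`() = (gsum 1 m a)^`() + (gsum 0 m b)^`().
  by rewrite !derivD derivC add0r.
have E1 : ((gsum 1 m a)^`() + (gsum 0 m b)^`()) ^+ 2 =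
   (gsum 1 m a)^`() ^+ 2 + (gsum 0 m b)^`() ^+ 2 +
   2%:P * ((gsum 1 m a)^`() * (gsum 0 m b)^`()) by ring.
have E2 : (c%:P + gsum 1 m a + gsum 0 m b) ^+ 2 =
   gsum 1 m a ^+ 2 + gsum 0 m b ^+ 2 + (c ^+ 2)%:P * 1
   + 2%:P * (gsum 1 m a * gsum 0 m b)
   + (2 * c)%:P * gsum 1 m a + (2 * c)%:P * gsum 0 m b by ring.
rewrite E1 E2 !linearD/= !LC !L_gsum L_gsum_orth L_deriv_gsum_orth.
rewrite !L_gsum_sqr !L_deriv_gsum_sqr !mulr0 !addr0 !mulrDr.
have q1 : quad (S 1) m a <= F * wsum (h 1) m a.
  by apply: quad_le => //; apply: le_trans UF; apply: frob_even_le => // u; exact: frobE.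
have q0 : quad (S 0) m b <= F * wsum (h 0) m b.
  by apply: quad_le => //; apply: le_trans UF; apply: frob_odd_le => // u; exact: frobE.
have c0 : 0 <= F * (c ^+ 2 * L 1).
  by rewrite mulr_ge0 ?(ltW F0)// mulr_ge0 ?sqr_ge0// ltW.
by lra.
Qed.

(** Testing on the even polynomials [gsum 1 m a] makes [c] a bound for the even block, so
    [frob_le_trace] applies; the factor of [c] is the trace. *)
Lemma markov_lower m c :
  (forall p : {poly R}, (size p <= m.*2.+1)%N -> L (p^`() ^+ 2) <= c * L (p ^+ 2)) ->
  lower (2 * m%:R) y <= c * ((2 * m%:R) * (2 * m%:R + 2) * (2 * m%:R + y - 1)
    * (2 * m%:R + y + 1) / (4 * y)).
Proof.
move=> H; apply: le_trans (frob_even_ge y_gt0 (h := h 1) (S := S 1) _ _) _.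
  by move=> u; exact: frobE.
rewrite -sum_eig//.
have -> : \sum_(u < m) eig (2 + 2 * u%:R) y = \sum_(u < m) S 1 u / h 1 u.
  by apply: eq_bigr => u _; rewrite ShE mulfK// gt_eqF.
apply: frob_le_trace => //.
- by apply: (S_ge0 y_gt0 (h_gt0 1) (ShE 1)); rewrite ler1n.
- move=> u; apply: (S_nondecreasing y_gt0 (h_gt0 1) (ShE 1) (SSE 1)).
  by rewrite ler1n.
- by move=> a; rewrite -L_gsum_sqr -L_deriv_gsum_sqr; apply: H; exact: size_gsum.
Qed.

End MarkovForm.

(** * The Gegenbauer weight *)

Section GegenbauerWeight.
Local Open Scope classical_set_scope.
Local Open Scope ring_scope.
Variables (R : realType) (lam : R).
Hypothesis lam_gt : -(2^-1) < lam.
Let mu := @lebesgue_measure R.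
Let I : set R := `](-1 : R), (1 : R)[%classic.
Local Notation w := (gweight lam).

Lemma measurable_gweight_poly (D : set R) (p : {poly R}) :
  measurable_fun D (fun t => w t * p.[t]).
Proof.
apply: measurable_funM; last exact: measurable_poly.
apply/measurable_funTS.
apply: (measurableT_comp (measurable_powR _)).
by apply: measurable_funB => //; exact: measurable_funX.
Qed.

(** The exponent [lam + 2^-1] is positive, so the function differentiated here tends to 0 at both
    endpoints: this is the source of the integration by parts. *)
Lemma is_derive_gweight (q : {poly R}) (t : R) : -1 < t < 1 ->
  is_derive t 1 (fun x => (1 - x ^+ 2) `^ (lam + 2^-1) * q.[x])
    (w t * ((1 - 'X^2) * q^`() - (2 * lam + 1)%:P * 'X * q).[t]).
Proof.
move=> t1; have t0 : 0 < 1 - t ^+ 2 by nra.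
have d1 : is_derive (1 - t ^+ 2) 1 (@powR R ^~ (lam + 2^-1))
    ((lam + 2^-1) * (1 - t ^+ 2) `^ (lam + 2^-1 - 1)).
  exact: is_derive1_powR.
have d2 : is_derive t 1 (fun x : R => 1 - x ^+ 2) (- (2 * t)).
  by apply: is_derive_eq; rewrite /GRing.scale/=; ring.
have d3 := @is_derive1_comp R (@powR R ^~ (lam + 2^-1)) (fun x => 1 - x ^+ 2) t _ _ d1 d2.
have d4 : is_derive t 1 (horner q) (q^`()).[t].
  split; first exact: derivable_horner.
  by rewrite -derive1E -derivE.
have d5 := is_deriveM d3 d4.
apply: is_derive_eq; rewrite !hornerE /GRing.scale/= /gweight.
have -> : lam + 2^-1 - 1 = lam - 2^-1 by lra.
have -> : (1 - t ^+ 2) `^ (lam + 2^-1) = (1 - t ^+ 2) `^ (lam - 2^-1) * (1 - t ^+ 2).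
  rewrite -[X in _ * X]powRr1 ?ltW// -powRD; last by rewrite (gt_eqF t0) implybT.
  by congr (_ `^ _); lra.
by field.
Qed.

Let prim (q : {poly R}) (t : R) := (1 - t ^+ 2) `^ (lam + 2^-1) * q.[t].
Let dprim (q : {poly R}) := (1 - 'X^2) * q^`() - (2 * lam + 1)%:P * 'X * q.

Lemma continuous_gweight (p : {poly R}) (t : R) : -1 < t < 1 ->
  {for t, continuous (fun x => w x * p.[x])}.
Proof.
move=> t1; have t0 : 0 < 1 - t ^+ 2 by nra.
apply: (@continuousM _ _ w (horner p)); last exact: continuous_horner.
apply: (@continuous_comp _ _ _ (fun x : R => 1 - x ^+ 2) (@powR R ^~ (lam - 2^-1))).
  by apply: differentiable_continuous; apply/derivable1_diffP.
apply: differentiable_continuous; apply/derivable1_diffP.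
by apply: derivable_powR; rewrite in_itv/= andbT.
Qed.

(** For [lam < 1/2] the weight is unbounded at the endpoints, so the fundamental theorem of calculus
    is first applied on compact subintervals. *)
Lemma integral_gweight_itv (q : {poly R}) (r : R) : 0 < r < 1 ->
  (\int[mu]_(t in `[(- r)%R, r]) (w t * (dprim q).[t])%:E =
   (prim q r - prim q (- r))%:E)%E.
Proof.
move=> r01.
have in1 t : t \in `[- r, r] -> -1 < t < 1 by rewrite in_itv/=; lra.
have cprim t : -1 < t < 1 -> {for t, continuous (prim q)}.
  move=> t1; apply: differentiable_continuous; apply/derivable1_diffP.
  by have [] := is_derive_gweight q t1.
rewrite (@continuous_FTC2 _ _ (prim q)) ?EFinB//.
- by lra.
- apply: continuous_in_subspaceT => t /set_mem tr.
  by apply: continuous_gweight; apply: in1.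
- split.
  + move=> t tr; have t1 : -1 < t < 1 by apply: in1; exact: subset_itv_oo_cc tr.
    by have [] := is_derive_gweight q t1.
  + by apply: cvg_at_right_filter; apply: cprim; lra.
  + by apply: cvg_at_left_filter; apply: cprim; lra.
- move=> t tr; have t1 : -1 < t < 1 by apply: in1; exact: subset_itv_oo_cc tr.
  by rewrite derive1E; have [_ ->] := is_derive_gweight q t1.
Qed.

Lemma gweight_ge0 t : 0 <= w t.
Proof. exact: powR_ge0. Qed.

Lemma gweight_mul_le1 t : -1 < t < 1 -> w t * (1 - t ^+ 2) <= 1.
Proof.
move=> t1; have t0 : 0 < 1 - t ^+ 2 by nra.
have -> : w t * (1 - t ^+ 2) = (1 - t ^+ 2) `^ (lam + 2^-1).
  rewrite -[X in _ * X]powRr1 ?ltW// -powRD; last by rewrite (gt_eqF t0) implybT.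
  by congr (_ `^ _); lra.
apply: (@le_trans _ _ ((1 - t ^+ 2) `^ 0)); last by rewrite powRr0.
apply: ger_powR; last by move: lam_gt; lra.
by rewrite t0/=; nra.
Qed.

Lemma integrable_gweight_itv (p : {poly R}) (r : R) : r < 1 ->
  mu.-integrable `[- r, r] (EFin \o (fun t => w t * p.[t])).
Proof.
move=> r1; apply: continuous_compact_integrable; first exact: segment_compact.
apply: continuous_in_subspaceT => t /set_mem; rewrite /= in_itv/= => tr.
by apply: continuous_gweight; lra.
Qed.

Local Notation wpoly p := (fun t : R => w t * p.[t]).

Lemma Rintegral_gweight_linear (D : set R) (c : R) (p q : {poly R}) :
  measurable D ->
  (forall p : {poly R}, mu.-integrable D (EFin \o wpoly p)) ->
  \int[mu]_(t in D) (w t * (c *: p + q).[t]) =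
  c * \int[mu]_(t in D) (w t * p.[t]) + \int[mu]_(t in D) (w t * q.[t]).
Proof.
move=> mD iD; rewrite -RintegralZl// -RintegralD//.
  by apply: eq_Rintegral => t _; rewrite hornerD hornerZ; ring.
suff -> : EFin \o (fun t => c * wpoly p t) = EFin \o wpoly (c *: p) by exact: iD.
by apply/funext => t /=; rewrite hornerZ mulrCA.
Qed.

(* [(2 lam + 1) w + w (dprim 'X) = (2 lam + 2) w (1 - t^2) <= 2 lam + 2], and the
   integral of [w (dprim 'X)] over [[- r, r]] is nonnegative. *)
Lemma Rintegral_gweight_itv_le (r : R) : 0 < r < 1 ->
  \int[mu]_(t in `[- r, r]) (w t * (1 : {poly R}).[t])
    <= 2 * (2 * lam + 2) / (2 * lam + 1).
Proof.
move=> r01; have y0 : 0 < 2 * lam + 1 by move: lam_gt; lra.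
have r1 : r < 1 by lra.
have ir p := integrable_gweight_itv p r1.
rewrite ler_pdivlMr// mulrC.
have mur : fine (mu `[- r, r]) = 2 * r.
  rewrite /mu lebesgue_measure_itv/= lte_fin ifT; last by lra.
  by rewrite -EFinB/=; ring.
have : \int[mu]_(t in `[- r, r]) (w t * ((2 * lam + 1) *: 1 + dprim 'X).[t])
    <= (2 * lam + 2) * (2 * r).
  rewrite -mur -Rintegral_cst//; apply: le_Rintegral => //.
  - apply: continuous_compact_integrable; first exact: segment_compact.
    by move=> t; exact: cst_continuous.
  - move=> t; rewrite /= in_itv/= => tr.
    have t1 : -1 < t < 1 by lra.
    have := gweight_mul_le1 t1; rewrite /dprim !hornerE derivX !hornerE => h.
    have l2 : 0 <= 2 * lam + 2 by lra.
    by have := ler_wpM2l l2 h; rewrite /=; lra.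
rewrite Rintegral_gweight_linear// [X in _ + X]/Rintegral.
rewrite integral_gweight_itv//=.
have : 0 <= prim 'X r - prim 'X (- r).
  rewrite /prim !hornerX sqrrN mulrN opprK.
  by rewrite addr_ge0// mulr_ge0 ?powR_ge0//; lra.
by nra.
Qed.

(** The intervals [J n] increase to the open interval; [n.+2] keeps the radius positive from [n = 0]
    on. *)
Let rad n : R := 1 - n.+2%:R^-1.
Let J n : set R := `[- rad n, rad n]%classic.

Let rad01 n : 0 < rad n < 1.
Proof.
rewrite /rad subr_gt0 invf_lt1 ?ltr0n// ltr1n/=.
by rewrite ltrBlDr ltrDl invr_gt0 ltr0n.
Qed.

Let rad_cvg : rad n @[n --> \oo] --> (1 : R).
Proof.
rewrite -[X in _ --> X]subr0; apply: cvgB; first exact: cvg_cst.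
by have := @cvg_harmonic R; rewrite -cvg_shiftS.
Qed.

Let J_nd : nondecreasing_seq J.
Proof.
move=> m n mn; apply/subsetPset => t; rewrite /J /= !in_itv/=.
have : rad m <= rad n by rewrite lerD2l lerN2 lef_pV2 ?posrE ?ltr0n// ler_nat.
by lra.
Qed.

Let J_sub n : J n `<=` I.
Proof. by move=> t; rewrite /J /I /= !in_itv/=; have := rad01 n; lra. Qed.

Let J_near t : I t -> \forall n \near \oo, J n t.
Proof.
rewrite /I /= in_itv/= => t1.
have : \forall n \near \oo, `|t| < rad n.
  by apply: (cvgr_gt _ rad_cvg); rewrite ltr_norml.
by apply: filterS => n; rewrite /J /= in_itv/= => /ltW; rewrite ler_norml.
Qed.

Let J_bigcup : \bigcup_n J n = I.
Proof.
apply/seteqP; split => [t [n _]|t It]; first exact: J_sub.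
by have [n _ /(_ n (leqnn n)) Jn] := J_near It; exists n.
Qed.

Lemma poly_bounded (p : {poly R}) :
  {M : R | 0 <= M & forall t, -1 <= t <= 1 -> `|p.[t]| <= M}.
Proof.
exists (\sum_(i < size p) `|p`_i|); first by apply: sumr_ge0.
move=> t t1; rewrite horner_coef; apply: le_trans (ler_norm_sum _ _ _) _.
apply: ler_sum => i _; rewrite normrM normrX ler_piMr// exprn_ile1//.
by rewrite ler_norml.
Qed.

(** For [p = 1], monotone convergence along [J n] with the uniform bound [Rintegral_gweight_itv_le];
    a general [p] is bounded on the interval, so a multiple of the weight dominates. *)
Lemma integrable_gweight (p : {poly R}) : mu.-integrable I (EFin \o wpoly p).
Proof.
have mI : measurable I by exact: measurable_itv.
have mw q : measurable_fun I (EFin \o wpoly q).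
  by apply/measurable_EFinP; exact: measurable_gweight_poly.
have i1 : mu.-integrable I (EFin \o wpoly (1 : {poly R})).
  apply/integrableP; split; first exact: mw.
  have w0 t : (0 <= (EFin \o wpoly (1 : {poly R})) t)%E.
    by rewrite /= lee_fin hornerC mulr1 gweight_ge0.
  under eq_integral do rewrite gee0_abs//.
  apply: (@le_lt_trans _ _ (2 * (2 * lam + 2) / (2 * lam + 1))%:E); last exact: ltry.
  have cJ : (\int[mu]_(t in J n) (EFin \o wpoly (1 : {poly R})) t @[n --> \oo] -->
      \int[mu]_(t in \bigcup_n J n) (EFin \o wpoly (1 : {poly R})) t)%E.
    apply: ge0_nondecreasing_set_cvg_integral => //.
    - by move=> i; exact: measurable_itv.
    - by move=> i; exact: measurable_funS (mw 1).
  rewrite J_bigcup in cJ; rewrite -(cvg_lim _ cJ)//.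
  apply: lime_le; first by apply/cvg_ex; eexists; exact: cJ.
  apply: nearW => n.
  have /andP[_ r1] := rad01 n.
  rewrite -[leLHS]fineK; first by rewrite lee_fin; exact: Rintegral_gweight_itv_le.
  apply: integrable_fin_num; first exact: measurable_itv.
  exact: integrable_gweight_itv.
have [M M0 hM] := poly_bounded p.
have iM : mu.-integrable I (fun t => (M%:E * (EFin \o wpoly (1%R : {poly R})) t)%E).
  by apply: integrableZl => //; exact: measurable_itv.
apply: le_integrable iM; [exact: measurable_itv|exact: mw|move=> t].
rewrite /I /= in_itv/= => t1.
rewrite lee_fin !normrM hornerC normr1 mulr1 mulrC ler_wpM2r//.
by rewrite (ger0_norm M0); apply: hM; lra.
Qed.

Lemma cvg_integral_gweight (p : {poly R}) :
  (\int[mu]_(t in J n) (w t * p.[t])%:E @[n --> \oo] -->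
   \int[mu]_(t in I) (w t * p.[t])%:E)%E.
Proof.
have mI : measurable I by exact: measurable_itv.
pose f := EFin \o wpoly p.
have mf : measurable_fun I f by have /integrableP[] := integrable_gweight p.
have e n : (\int[mu]_(t in J n) f t = \int[mu]_(t in I) (f \_ (J n)) t)%E.
  by rewrite -integral_mkcondr (setIidr (@J_sub n)).
have -> : (fun n => \int[mu]_(t in J n) (w t * p.[t])%:E)%E =
    (fun n => \int[mu]_(t in I) (f \_ (J n)) t)%E by apply/funext => n; exact: e.
apply: (@dominated_cvg _ _ R mu I _ (fun n => f \_ (J n)) f (fun t => `|f t|%E)).
- exact: measurable_itv.
- move=> n; apply/measurable_restrict => //; first exact: measurable_itv.
  by apply: measurable_funS mf => // t [].
- move=> t It; apply: cvg_near_cst; have := J_near It.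
  by apply: filterS => n Jt; rewrite patchE mem_set.
- by move=> t _.
- exact: integrable_abse (integrable_gweight p).
- by move=> n t It; rewrite patchE; case: ifP => //= _; rewrite normr0 lee_fin.
Qed.

Definition gform (p : {poly R}) : R := \int[mu]_(t in I) (w t * p.[t]).

(** On [J n] the integral is a difference of boundary values of [prim q], at most [2 * M] times
    [1 - rad n ^+ 2] to the positive power [lam + 2^-1], which tends to 0. *)
Lemma gform_dprim q : gform (dprim q) = 0.
Proof.
have [M M0 hM] := poly_bounded q.
have c0 : prim q (rad n) - prim q (- rad n) @[n --> \oo] --> (0 : R).
  have cp : (1 - rad n ^+ 2) `^ (lam + 2^-1) @[n --> \oo] --> (0 : R).
    have l0 : 0 < lam + 2^-1 by move: lam_gt; lra.
    apply: (proj1 (cvg_at_rightP _ _ _) (powR_cvg0 l0)); split => [n|].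
      by have := rad01 n; nra.
    have -> : (0 : R) = 1 - 1 ^+ 2 by ring.
    apply: cvgB; first exact: cvg_cst.
    by rewrite expr2; apply: cvgM; exact: rad_cvg.
  have c2 : (1 - rad n ^+ 2) `^ (lam + 2^-1) * (2 * M) @[n --> \oo] --> (0 : R).
    by rewrite -[X in _ --> X](mul0r (2 * M)); apply: cvgM => //; exact: cvg_cst.
  have c3 : - ((1 - rad n ^+ 2) `^ (lam + 2^-1) * (2 * M)) @[n --> \oo] --> (0 : R).
    by rewrite -[X in _ --> X]oppr0; exact: cvgN.
  apply: (squeeze_cvgr _ c3 c2); apply: nearW => n.
  rewrite -ler_norml /prim sqrrN -mulrBr normrM (ger0_norm (powR_ge0 _ _)).
  rewrite ler_wpM2l ?powR_ge0//; apply: le_trans (ler_normB _ _) _.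
  have := rad01 n => ?.
  have r1 : -1 <= rad n <= 1 by lra.
  have r2 : -1 <= - rad n <= 1 by lra.
  by have := hM _ r1; have := hM _ r2; lra.
have c1 := @cvg_integral_gweight (dprim q).
have {}c0 : ((prim q (rad n) - prim q (- rad n))%:E @[n --> \oo] --> 0%:E)%E.
  by apply: cvg_EFin; [exact: nearW|exact: c0].
have e n : (\int[mu]_(t in J n) (w t * (dprim q).[t])%:E)%E =
    (prim q (rad n) - prim q (- rad n))%:E by exact: integral_gweight_itv.
rewrite /gform /Rintegral; move: c1; under eq_fun do rewrite e.
by move=> c1; rewrite -(cvg_lim _ c1)// (cvg_lim _ c0).
Qed.

Lemma gform_linear c p q : gform (c *: p + q) = c * gform p + gform q.
Proof.
apply: Rintegral_gweight_linear; first exact: measurable_itv.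
exact: integrable_gweight.
Qed.

(** On [[-1/2, 1/2]] the weight dominates its product with [dprim 'X], that is
    [1 - (2 lam + 2) t^2], whose integral is a positive difference of boundary values. *)
Lemma gform1_gt0 : 0 < gform 1.
Proof.
have r01 : 0 < (2^-1 : R) < 1 by lra.
have r1 : 2^-1 < 1 :> R by lra.
have w0 t : (0 <= (w t * (1 : {poly R}).[t])%:E)%E.
  by rewrite lee_fin hornerC mulr1 gweight_ge0.
pose K := \int[mu]_(t in `[- 2^-1, 2^-1]) (w t * (1 : {poly R}).[t]).
have K0 : 0 < K.
  apply: (@lt_le_trans _ _ (\int[mu]_(t in `[- 2^-1, 2^-1]) (w t * (dprim 'X).[t]))).
    rewrite /Rintegral integral_gweight_itv//= /prim !hornerX sqrrN mulrN opprK.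
    by rewrite addr_gt0// mulr_gt0// ?powR_gt0//; lra.
  apply: le_Rintegral; [exact: measurable_itv|exact: integrable_gweight_itv..|].
  move=> t _; rewrite ler_wpM2l ?gweight_ge0//.
  rewrite /dprim !hornerE derivX !hornerE/=.
  by have := lam_gt; have := sqr_ge0 t; nra.
apply: lt_le_trans K0 _; rewrite /K /gform /Rintegral.
have mJ : measurable_fun I (fun t => (w t * (1 : {poly R}).[t])%:E).
  by apply/measurable_EFinP; exact: measurable_gweight_poly.
apply: fine_le.
- apply: integrable_fin_num; first exact: measurable_itv.
  exact: integrable_gweight_itv.
- apply: integrable_fin_num; first exact: measurable_itv.
  exact: integrable_gweight.
- apply: ge0_subset_integral; [exact: measurable_itv..|exact: mJ|by []|].
  by move=> t; rewrite /I /= !in_itv/=; lra.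
Qed.

Lemma wnorm_gform p : wnorm lam (fun t => p.[t]) = Num.sqrt (gform (p ^+ 2)).
Proof.
rewrite /wnorm /wint /gform /Rintegral; congr (Num.sqrt (fine _)).
by apply: eq_integral => t _; rewrite horner_exp.
Qed.

Lemma gform_sqr_ge0 p : 0 <= gform (p ^+ 2).
Proof.
apply: Rintegral_ge0 => t _.
by rewrite horner_exp mulr_ge0 ?sqr_ge0// gweight_ge0.
Qed.

Lemma gform_ibp q : gform ((1 - 'X^2) * q^`()) = (2 * lam + 1) * gform ('X * q).
Proof.
have -> : (1 - 'X^2) * q^`() = (2 * lam + 1) *: ('X * q) + dprim q.
  by rewrite /dprim -mul_polyC; ring.
by rewrite gform_linear gform_dprim addr0.
Qed.

Lemma gform_scalar : {L : {scalar {poly R}} | L =1 gform}.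
Proof.
pose L : {scalar {poly R}} := HB.pack gform
  (GRing.isLinear.Build R {poly R} R *%R gform gform_linear).
by exists L.
Qed.

End GegenbauerWeight.

(** * The Markov constant *)

Section MarkovConstant.
Variables (R : realType) (lam : R).
Hypothesis lam_gt : -(2^-1) < lam.
Local Notation y := (2 * lam + 1).

Lemma gform_markov_upper m (p : {poly R}) F : 0 < F ->
  upper (2 * m%:R) y <= F ^+ 2 -> (size p <= m.*2.+1)%N ->
  gform lam (p^`() ^+ 2) <= F * gform lam (p ^+ 2).
Proof.
have [L LE] := gform_scalar lam_gt; rewrite -!LE; apply: markov_upper => //.
- by rewrite LE gform1_gt0.
- by move=> q; rewrite !LE gform_ibp.
Qed.

Lemma gform_markov_lower m c :
  (forall p : {poly R}, (size p <= m.*2.+1)%N ->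
    gform lam (p^`() ^+ 2) <= c * gform lam (p ^+ 2)) ->
  lower (2 * m%:R) y <= c * ((2 * m%:R) * (2 * m%:R + 2) * (2 * m%:R + y - 1)
    * (2 * m%:R + y + 1) / (4 * y)).
Proof.
have [L LE] := gform_scalar lam_gt => H.
apply: (@markov_lower _ _ lam_gt L).
- by rewrite LE gform1_gt0.
- by move=> q; rewrite !LE gform_ibp.
- by move=> p sp; rewrite !LE; exact: H.
Qed.

Lemma markov_ratio_le (p : {poly R}) F : 0 <= F ->
  gform lam (p^`() ^+ 2) <= F * gform lam (p ^+ 2) ->
  wnorm lam (fun t => (p^`()).[t]) / wnorm lam (fun t => p.[t]) <= Num.sqrt F.
Proof.
move=> F0 pF; rewrite !wnorm_gform.
(* If the norm of [p] is 0, the quotient is 0 because [0^-1 = 0]. *)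
have := gform_sqr_ge0 lam p; rewrite le_eqVlt => /predU1P[<-|g0].
  by rewrite sqrtr0 invr0 mulr0 sqrtr_ge0.
by rewrite ler_pdivrMr ?sqrtr_gt0// -sqrtrM// ler_wsqrtr.
Qed.

(** A bound [F] makes the set of ratios bounded above, so that its [sup] really dominates each
    ratio. *)
Lemma gform_le_markov_const n F (p : {poly R}) : 0 < F ->
  (forall q : {poly R}, (size q <= n.+1)%N ->
    gform lam (q^`() ^+ 2) <= F * gform lam (q ^+ 2)) ->
  (size p <= n.+1)%N ->
  gform lam (p^`() ^+ 2) <= markov_const n lam ^+ 2 * gform lam (p ^+ 2).
Proof.
move=> F0 qF sp; have := gform_sqr_ge0 lam p.
rewrite le_eqVlt => /predU1P[g0|g0].
  by have := qF p sp; rewrite -g0 !mulr0.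
have p0 : p != 0.
  apply: contraTneq g0 => ->; rewrite expr0n/=.
  have := @gform_linear _ _ lam_gt (-1) 0 0; rewrite scaler0 addr0 => ->.
  by rewrite mulN1r addNr ltxx.
have : wnorm lam (fun t => (p^`()).[t]) / wnorm lam (fun t => p.[t])
    <= markov_const n lam.
  apply: ub_le_sup; last by exists p.
  by exists (Num.sqrt F) => _ [q [sq _] <-]; apply: markov_ratio_le (ltW F0) (qF q sq).
rewrite !wnorm_gform ler_pdivrMr ?sqrtr_gt0// => h.
rewrite -[leLHS]sqr_sqrtr ?gform_sqr_ge0// -[X in _ * X]sqr_sqrtr ?gform_sqr_ge0//.
by rewrite -exprMn lerXn2r ?nnegrE ?sqrtr_ge0// (le_trans _ h) ?sqrtr_ge0.
Qed.

Lemma markov_const_sqr_le n F : 0 < F ->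
  (forall q : {poly R}, (size q <= n.+1)%N ->
    gform lam (q^`() ^+ 2) <= F * gform lam (q ^+ 2)) ->
  markov_const n lam ^+ 2 <= F.
Proof.
move=> F0 qF.
set A := [set wnorm lam (fun t => (p^`()).[t]) / wnorm lam (fun t => p.[t])
      | p in [set p : {poly R} | (size p <= n.+1)%N /\ p != 0]]%classic.
have ubA : ubound A (Num.sqrt F).
  by move=> _ [q [sq _] <-]; apply: markov_ratio_le (ltW F0) (qF q sq).
(* The constant 1 shows that the set is nonempty and that its [sup] is nonnegative, as comparing
   squares requires. *)
have A1 : A (wnorm lam (fun t => ((1 : {poly R})^`()).[t])
    / wnorm lam (fun t => (1 : {poly R}).[t])).
  by exists 1 => //; split; [rewrite size_poly1|exact: oner_neq0].
have M0 : 0 <= sup A.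
  apply: le_trans (ub_le_sup _ A1); last by exists (Num.sqrt F).
  by rewrite divr_ge0 ?sqrtr_ge0.
rewrite -[leRHS](sqr_sqrtr (ltW F0)) lerXn2r ?nnegrE ?sqrtr_ge0//.
by apply: ge_sup; first by eexists; exact: A1.
Qed.

End MarkovConstant.

Theorem theorem4p2 (R : realType) (n : nat) (lam : R) :
  (4 <= n)%N -> ~~ odd n -> -(2^-1) < lam ->
  let N := n%:R : R in
  (N + 2) * (N + 2 * lam) * (N + lam + 2^-1) ^+ 2
      / ((2 * lam + 1) * (2 * lam + 5))
    <= markov_const n lam ^+ 2
  /\ markov_const n lam ^+ 2
    <= N * (N + 2 * lam) * (N + 2 * lam + 2)
         * Num.sqrt ((N + 2) * (N + 2 * lam + 3))
       / (2 * (2 * lam + 1) * Num.sqrt (2 * lam + 5)).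
Proof.
move=> n4 n_even lam_gt N; set F := (X in _ /\ _ <= X).
have nE : n = (n./2).*2 by rewrite -[LHS]odd_double_half (negbTE n_even).
have NE : 2 * (n./2)%:R = N by rewrite /N [in RHS]nE -muln2 natrM mulrC.
have N4 : 4 <= N by rewrite /N ler_nat.
have s1_gt0 : 0 < Num.sqrt ((N + 2) * (N + 2 * lam + 3)).
  by rewrite sqrtr_gt0 mulr_gt0//; lra.
have s2_gt0 : 0 < Num.sqrt (2 * lam + 5) by rewrite sqrtr_gt0; lra.
have F_gt0 : 0 < F by rewrite /F divr_gt0// !mulr_gt0//; lra.
have UF : upper N (2 * lam + 1) <= F ^+ 2.
  rewrite /F expr_div_n !exprMn !sqr_sqrtr; [|lra|by rewrite mulr_ge0//; lra].
  rewrite le_eqVlt; apply/predU1P; left; rewrite /upper; field.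
  by rewrite !gt_eqF//; lra.
have qF (q : {poly R}) : (size q <= n.+1)%N ->
    gform lam (q^`() ^+ 2) <= F * gform lam (q ^+ 2).
  move=> sq; apply: (@gform_markov_upper _ _ lam_gt n./2) => //.
    by rewrite NE.
  by rewrite -nE.
split; last exact: markov_const_sqr_le F_gt0 qF.
(* The squared Markov constant is itself an admissible [c], by [gform_le_markov_const]; it remains
   to divide by the trace [T]. *)
have := @gform_markov_lower _ _ lam_gt n./2 (markov_const n lam ^+ 2).
rewrite NE -nE => /(_ (fun p sp => gform_le_markov_const lam_gt F_gt0 qF sp)).
set M := markov_const n lam ^+ 2.
set T := (X in _ <= M * X) => H.
have T_gt0 : 0 < T by rewrite /T divr_gt0// !mulr_gt0//; lra.
rewrite -(ler_pM2r T_gt0); apply: le_trans H.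
rewrite le_eqVlt; apply/predU1P; left; rewrite /T /lower; field.
by rewrite !gt_eqF//; lra.
Qed.
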